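(* $\mathbf T_{m+1}$ is a Poisson submanifold of $(\mathfrak g,{\rm PB}_2({\rm A}_1,{\rm A}_2,{\rm S}))$, and the induced bracket is given, for $1\le i,j\le m$ and all $k$, by $\{b_k,b_{k+1}\}_2=-a_k^{(1)}$; $\{b_k,a_{k+1}^{(j)}\}_2=-a_k^{(j+1)}$, $\{a_k^{(j)},b_{k+j+1}\}_2=-a_k^{(j+1)}$; $\{b_k,a_k^{(j)}\}_2=-b_ka_k^{(j)}$, $\{a_k^{(j)},b_{k+j}\}_2=-a_k^{(j)}b_{k+j}$; $\{a_k^{(i)},a_{k+i+1}^{(j)}\}_2=-a_k^{(i+j+1)}$; for $i<j$: $\{a_k^{(i)},a_k^{(j)}\}_2=-a_k^{(i)}a_k^{(j)}$ and $\{a_k^{(j)},a_{k+j-i}^{(i)}\}_2=-a_k^{(j)}a_{k+j-i}^{(i)}$; for $i\le j$ and $1\le\ell\le i$: $\{a_k^{(i)},a_{k+\ell}^{(j)}\}_2=-a_k^{(i)}a_{k+\ell}^{(j)}-a_k^{(j+\ell)}a_{k+\ell}^{(i-\ell)}$; for $i\le j$ and $j-i+1\le\ell\le j$: $\{a_k^{(j)},a_{k+\ell}^{(i)}\}_2=-a_k^{(j)}a_{k+\ell}^{(i)}-a_k^{(i+\ell)}a_{k+\ell}^{(j-\ell)}$; all other brackets between coordinate functions (other than those obtained by antisymmetry) vanish. (Here $N\ge2m+2$, so that the index patterns are distinct modulo $N$.)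
   Context: Periodic lattice setting. Fix integers $N\ge2$, $m\ge1$, $\omega=e^{2\pi i/N}$, $\Omega=\mathrm{diag}(1,\omega,\dots,\omega^{N-1})$. $\mathfrak g=\{X(\lambda)\in gl(N)[\lambda,\lambda^{-1}]:\Omega X(\lambda)\Omega^{-1}=X(\omega\lambda)\}$ (finite sums $\sum_p\lambda^p\sum_{j-k\equiv p\,(\mathrm{mod}\,N)}x^{(p)}_{jk}E_{jk}$), matrix indices and lattice subscripts modulo $N$; scalar product $\langle X,Y\rangle$ = coefficient of $\lambda^0$ in $\mathrm{tr}(XY)$. $\mathfrak g_p$ = elements $\lambda^p\sum_{j-k\equiv p}x_{jk}E_{jk}$; $P_0,P_{>0},P_{<0}$ etc. are the projections onto $\mathfrak g_0$, $\oplus_{p>0}\mathfrak g_p$, $\oplus_{p<0}\mathfrak g_p$, etc. ${\rm R}_0=P_{>0}-P_{<0}$. $W$ is linear with $W=W\circ P_0$ and $W(E_{kk})=\sum_{j=1}^N\mathrm{sgn}(k-j)E_{jj}$. ${\rm A}_1={\rm R}_0+W$, ${\rm A}_2={\rm R}_0-W$, ${\rm S}=P_0-W$, ${\rm S}^*=P_0+W$. Gradient: $\langle\nabla\varphi(L),M\rangle=\frac{d}{d\varepsilon}\varphi(L+\varepsilon M)|_{\varepsilon=0}$; $d\varphi=L\nabla\varphi$, $d'\varphi=\nabla\varphi L$. ${\rm PB}_2({\rm A}_1,{\rm A}_2,{\rm S})$: $\{\varphi,\psi\}_2(L)=\frac12\langle{\rm A}_1(d'\varphi),d'\psi\rangle-\frac12\langle{\rm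 A}_2(d\varphi),d\psi\rangle+\frac12\langle{\rm S}(d\varphi),d'\psi\rangle-\frac12\langle{\rm S}^*(d'\varphi),d\psi\rangle$. $\mathcal E=\lambda\sum_kE_{k+1,k}$; $\mathbf T_{m+1}$ = set of $T=\mathcal E+\sum_kb_kE_{kk}+\sum_{j=1}^m\lambda^{-j}\sum_ka_k^{(j)}E_{k,k+j}$; coordinate functions $b_k(X)$ = coefficient of $\lambda^0E_{kk}$, $a_k^{(j)}(X)$ = coefficient of $\lambda^{-j}E_{k,k+j}$. Convention: $a_k^{(0)}=b_k$, $a_k^{(i)}=0$ for $i<0$ or $i>m$. *)

(* Defs.v *)
From HB Require Import structures.
From mathcomp Require Import all_boot all_order all_algebra.
From mathcomp Require Import finmap.
Set Implicit Arguments. Unset Strict Implicit. Unset Printing Implicit Defensive.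
Import Order.TTheory GRing.Theory Num.Theory.
Local Open Scope ring_scope.


Section Lattice.
Variables (R : numClosedFieldType) (N m : nat).

(* A formal Laurent series in lambda with N x N matrix coefficients and finite
   support: X p = coefficient of lambda^p.  Matrix indices are 0..N-1
   (i.e. the paper's 1..N shifted; everything is modulo N anyway). *)
Definition loop := {fsfun int -> 'M[R]_N with 0}.

Definition in_g (X : loop) : Prop :=
  forall (p : int) (i j : 'I_N), X p i j != 0 -> (i%:Z - j%:Z = p %[mod N%:Z])%Z.

Definition lmul (X Y : loop) : loop :=
  [fsfun p in [fset (a + b)%R | a in finsupp X, b in finsupp Y]%fset =>
     \sum_(q <- finsupp X) X q *m Y (p - q)].
Definition ladd (X Y : loop) : loop :=
  [fsfun p in (finsupp X `|` finsupp Y)%fset => X p + Y p].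
Definition lopp (X : loop) : loop := [fsfun p in finsupp X => - X p].
Definition lscale (e : R) (X : loop) : loop := [fsfun p in finsupp X => e *: X p].

Definition pair (X Y : loop) : R := \tr (lmul X Y 0).

Definition P0 (X : loop) : loop := [fsfun p in finsupp X => if p == 0 then X p else 0].
Definition Ppos (X : loop) : loop := [fsfun p in finsupp X => if 0 < p then X p else 0].
Definition Pneg (X : loop) : loop := [fsfun p in finsupp X => if p < 0 then X p else 0].
Definition R0 (X : loop) : loop := ladd (Ppos X) (lopp (Pneg X)).

Definition Wmat (M : 'M[R]_N) : 'M[R]_N :=
  \matrix_(i, j) if i == j then \sum_(k < N) (sgz (k%:Z - j%:Z))%:~R * M k k else 0.
Definition Wop (X : loop) : loop :=
  [fsfun p in finsupp X => if p == 0 then Wmat (X 0) else 0].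

Definition A1 (X : loop) : loop := ladd (R0 X) (Wop X).
Definition A2 (X : loop) : loop := ladd (R0 X) (lopp (Wop X)).
Definition Sop (X : loop) : loop := ladd (P0 X) (lopp (Wop X)).
Definition Sstar (X : loop) : loop := ladd (P0 X) (Wop X).

(* PB_2(A1,A2,S) evaluated at L on gradients G = grad phi(L), H = grad psi(L):
   d phi = L G, d' phi = G L. *)
Definition PB2 (L G H : loop) : R :=
    2^-1 * pair (A1 (lmul G L)) (lmul H L)
  - 2^-1 * pair (A2 (lmul L G)) (lmul L H)
  + 2^-1 * pair (Sop (lmul L G)) (lmul H L)
  - 2^-1 * pair (Sstar (lmul G L)) (lmul L H).

Definition deriv_at0 (f : R -> R) (d : R) : Prop :=
  exists P : {poly R}, (forall e, f e = P.[e]) /\ P^`().[0] = d.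

Definition is_grad (phi : loop -> R) (L G : loop) : Prop :=
  in_g G /\ forall M, in_g M ->
    deriv_at0 (fun e => phi (ladd L (lscale e M))) (pair G M).

Definition PBval (phi psi : loop -> R) (L : loop) (v : R) : Prop :=
  (exists G H, is_grad phi L G /\ is_grad psi L H) /\
  forall G H, is_grad phi L G -> is_grad psi L H -> PB2 L G H = v.

Definition ent (M : 'M[R]_N) (i j : nat) : R :=
  match insub (i %% N)%N , insub (j %% N)%N with
  | Some a, Some b => M a b
  | _, _ => 0
  end.

Definition bcoord (k : nat) (X : loop) : R := ent (X 0) k k.
Definition acoord (j k : nat) (X : loop) : R := ent (X (- (j%:Z))) k (k + j).
Definition aconv (j k : nat) (X : loop) : R :=
  if j == 0%N then bcoord k X else if (j <= m)%N then acoord j k X else 0.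

(* the manifold T_{m+1}: L = E + sum_k b_k E_kk + sum_{j=1}^m lambda^{-j} sum_k a^{(j)}_k E_{k,k+j} *)
Definition Ecoef (p : int) : 'M[R]_N :=
  if p == 1 then \matrix_(i, j) ((i : nat) == (j.+1 %% N)%N)%:R else 0.
Definition Dcoef (b : nat -> R) (a : nat -> nat -> R) (p : int) : 'M[R]_N :=
  if p == 0 then \matrix_(i, j) ((i == j)%:R * b i)
  else if (p < 0) && (`|p|%N <= m)%N then
    \matrix_(i, j) (((j : nat) == ((i + `|p|) %% N)%N)%:R * a `|p|%N i)
  else 0.
Definition inT (L : loop) : Prop :=
  exists b a, forall p, L p = Ecoef p + Dcoef b a p.
Definition tangentT (V : loop) : Prop :=
  exists b a, forall p, V p = Dcoef b a p.

(* Poisson submanifold: at every point of T every Hamiltonian vector field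
   (the V with {psi, phi}(L) = <grad psi, V> for all psi) is tangent to T *)
Definition poisson_submanifold : Prop :=
  forall L, inT L -> forall G, in_g G ->
    exists V, tangentT V /\ forall H, in_g H -> PB2 L H G = pair H V.

(* the index patterns (first coordinate a^{(i)}_k, second a^{(j)}_l; 0 = b)
   for which the theorem lists a bracket formula *)
Definition listed (i k j l : nat) : Prop :=
     (l = k + i + 1 %[mod N])%N
  \/ ((i < j)%N /\ l = k %[mod N])%N
  \/ ((j < i)%N /\ l = k + i - j %[mod N])%N
  \/ ((i <= j)%N /\ exists ell, (1 <= ell <= i)%N /\ l = k + ell %[mod N])%N
  \/ ((j <= i)%N /\ exists ell, (i - j + 1 <= ell <= i)%N /\ l = k + ell %[mod N])%N.

End Lattice.

(* Main.v *)
Require Import Defs.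
From HB Require Import structures.
From mathcomp Require Import all_boot all_order all_algebra.
From mathcomp Require Import finmap.
From mathcomp Require Import zify ring.
Set Implicit Arguments. Unset Strict Implicit. Unset Printing Implicit Defensive.
Import Order.TTheory GRing.Theory Num.Theory.
Local Open Scope ring_scope.

(** Write A = L G and B = G L for a gradient G.  Since R_0 and W are skew and
    S, S^* are mutually adjoint, {psi, phi}(L) = <grad psi, V> with
      V = (P_{>0} A + D) L - L (P_{>0} B + D),
      D = (A_0 + B_0 - W (A_0 - B_0)) / 2.
    As A L = L B, also V = (D - A_0 - P_{<0} A) L - L (D - B_0 - P_{<0} B).  The
    first form shows that V has no terms of degree < -m and the second that it
    has none of degree > 1; the coefficient of degree 1 vanishes because
    u = A_0 - B_0 has trace 0, so that (W u)_k - (W u)_{k+1} = u_k + u_{k+1} for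
    all k mod N.  So V is tangent to T.
    For G the gradient of a_l^(j), the entry of V at a_k^(i) is a sum of
    products of coordinates over s = 1..j+1, plus
    a_k^(i) a_l^(j) (chi(k) - chi(k+i)), where chi is the indicator function of
    the cyclic interval [l, l+j].  For N >= 2m+2 at most one s contributes to
    each sum, and every bracket can be read off from d = l - k mod N. *)

(** * The ring of matrix Laurent polynomials, its trace form and the Hamiltonian field *)

Section LoopRing.
Variables (R : numClosedFieldType) (N : nat).
Implicit Types (X Y Z : loop R N) (p q : int) (s : seq int).

Definition mono p (M : 'M[R]_N) : loop R N := [fsfun q in [fset p]%fset => M].

Lemma loopE X p : p \notin finsupp X -> X p = 0.
Proof. exact: fsfun_dflt. Qed.

Lemma monoE p M q : mono p M q = if q == p then M else 0.
Proof. by rewrite fsfunE inE. Qed.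

(** Any duplicate-free list covering the support of the left factor may index the convolution, so
    explicit ranges of degrees can be used later. *)
Lemma lmulE s X Y p : uniq s -> (forall q, X q != 0 -> q \in s) ->
  lmul X Y p = \sum_(q <- s) X q *m Y (p - q).
Proof.
move=> us Xs.
have suppE : \sum_(q <- finsupp X) X q *m Y (p - q) = \sum_(q <- s) X q *m Y (p - q).
  rewrite [RHS](bigID (fun q => q \in finsupp X)) /= [X in _ + X]big1 ?addr0; last first.
    by move=> q /loopE ->; rewrite mul0mx.
  rewrite -[RHS]big_filter; apply: perm_big.
  apply: uniq_perm; rewrite ?filter_uniq ?fset_uniq //.
  by move=> q; rewrite mem_filter; case: finsuppP => //= /[!mem_finsupp] /Xs ->.
(* Outside the declared support of [lmul] the convolution is 0 anyway: a nonzero term would exhibit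
   p as a sum of two support degrees. *)
rewrite fsfunE; case: ifPn => // /imfset2P pXY.
rewrite -suppE big_seq big1 // => q qX.
case: (finsuppP Y (p - q)) => [_|qY]; rewrite ?mulmx0 //.
by case: pXY; exists q => //; exists (p - q) => //; rewrite addrC subrK.
Qed.

Lemma lmul_suppl X Y p : lmul X Y p = \sum_(q <- finsupp X) X q *m Y (p - q).
Proof. by apply: lmulE => [|q]; rewrite ?fset_uniq ?mem_finsupp. Qed.

Lemma lmulEr s X Y p : uniq s -> (forall q, Y q != 0 -> q \in s) ->
  lmul X Y p = \sum_(q <- s) X (p - q) *m Y q.
Proof.
move=> us Ys.
have inj : injective (fun q : int => p - q) by move=> a b /addrI/oppr_inj.
pose t : seq int := [seq p - q | q <- s].
rewrite (@lmulE (undup (finsupp X ++ t))) ?undup_uniq //; last first.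
  by move=> q Xq; rewrite mem_undup mem_cat mem_finsupp Xq.
rewrite (bigID (fun q => q \in t)) /= [X in _ + X]big1 ?addr0; last first.
  move=> q qt; case: (eqVneq (Y (p - q)) 0) => [->|/Ys Yq]; first by rewrite mulmx0.
  by case/negP: qt; apply/mapP; exists (p - q) => //; rewrite opprB addrC subrK.
rewrite -big_filter (perm_big t) /=.
  rewrite big_map; apply: eq_bigr => q _; congr (_ *m Y _); by rewrite opprB addrC subrK.
apply: uniq_perm; rewrite ?filter_uniq ?undup_uniq ?(map_inj_uniq inj) //.
by move=> q; rewrite mem_filter mem_undup mem_cat; case: (q \in t); rewrite ?orbT.
Qed.

Lemma lmul_suppr X Y p : lmul X Y p = \sum_(q <- finsupp Y) X (p - q) *m Y q.
Proof. by apply: lmulEr => [|q]; rewrite ?fset_uniq ?mem_finsupp. Qed.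

Lemma laddE X Y p : ladd X Y p = X p + Y p.
Proof.
rewrite fsfunE in_fsetU; case: ifPn => //.
by rewrite negb_or => /andP[/loopE -> /loopE ->]; rewrite addr0.
Qed.

Lemma loppE X p : lopp X p = - X p.
Proof. by rewrite fsfunE; case: ifPn => // /loopE ->; rewrite oppr0. Qed.

Lemma lscaleE e X p : lscale e X p = e *: X p.
Proof. by rewrite fsfunE; case: ifPn => // /loopE ->; rewrite scaler0. Qed.

Lemma laddA : associative (@ladd R N).
Proof. by move=> X Y Z; apply/fsfunP=> p; rewrite !laddE addrA. Qed.
Lemma laddC : commutative (@ladd R N).
Proof. by move=> X Y; apply/fsfunP=> p; rewrite !laddE addrC. Qed.
Lemma ladd0 : left_id (mono 0 0) (@ladd R N).
Proof. by move=> X; apply/fsfunP=> p; rewrite laddE monoE if_same add0r. Qed.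
Lemma laddN : left_inverse (mono 0 0) (@lopp R N) (@ladd R N).
Proof. by move=> X; apply/fsfunP=> p; rewrite laddE loppE monoE if_same addNr. Qed.

Lemma lmulA : associative (@lmul R N).
Proof.
move=> X Y Z; apply/fsfunP=> p; rewrite lmul_suppl lmul_suppr.
under eq_bigr do rewrite lmul_suppr mulmx_sumr.
under [RHS]eq_bigr do rewrite lmul_suppl mulmx_suml.
rewrite exchange_big; apply: eq_bigr => a _; apply: eq_bigr => b _.
by rewrite mulmxA addrAC.
Qed.

Lemma lmul1l : left_id (mono 0 1%:M) (@lmul R N).
Proof.
move=> X; apply/fsfunP=> p; rewrite (@lmulE [:: 0]) // ?big_seq1.
  by rewrite monoE eqxx mul1mx subr0.
by move=> q; rewrite monoE inE; case: ifP; rewrite ?eqxx.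
Qed.
Lemma lmul1r : right_id (mono 0 1%:M) (@lmul R N).
Proof.
move=> X; apply/fsfunP=> p; rewrite (@lmulEr [:: 0]) // ?big_seq1.
  by rewrite monoE eqxx mulmx1 subr0.
by move=> q; rewrite monoE inE; case: ifP; rewrite ?eqxx.
Qed.
Lemma lmulDl : left_distributive (@lmul R N) (@ladd R N).
Proof.
move=> X Y Z; apply/fsfunP=> p; rewrite laddE !lmul_suppr -big_split /=.
by apply: eq_bigr => q _; rewrite laddE mulmxDl.
Qed.
Lemma lmulDr : right_distributive (@lmul R N) (@ladd R N).
Proof.
move=> X Y Z; apply/fsfunP=> p; rewrite laddE !lmul_suppl -big_split /=.
by apply: eq_bigr => q _; rewrite laddE mulmxDr.
Qed.

(** The structure is the one that does not ask for 1 != 0, since this fails for N = 0. *)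
HB.instance Definition _ := Choice.on (loop R N).
HB.instance Definition _ := GRing.isZmodule.Build (loop R N) laddA laddC ladd0 laddN.
HB.instance Definition _ := GRing.Zmodule_isPzRing.Build (loop R N)
  lmulA lmul1l lmul1r lmulDl lmulDr.

Lemma addlE X Y p : (X + Y) p = X p + Y p. Proof. exact: laddE. Qed.
Lemma opplE X p : (- X) p = - X p. Proof. exact: loppE. Qed.
Lemma zerolE p : (0 : loop R N) p = 0. Proof. by rewrite monoE if_same. Qed.

Lemma pairE s X Y : uniq s -> (forall q, X q != 0 -> q \in s) ->
  pair X Y = \sum_(q <- s) \tr (X q *m Y (- q)).
Proof.
move=> us Xs; rewrite /pair (lmulE _ _ us Xs) raddf_sum /=.
by under eq_bigr do rewrite sub0r.
Qed.

Lemma pair_suppl X Y : pair X Y = \sum_(q <- finsupp X) \tr (X q *m Y (- q)).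
Proof. by apply: pairE => [|q]; rewrite ?fset_uniq ?mem_finsupp. Qed.

Lemma pairC X Y : pair X Y = pair Y X.
Proof.
rewrite pair_suppl /pair lmul_suppr raddf_sum /=.
by apply: eq_bigr => q _; rewrite sub0r mxtrace_mulC.
Qed.

Lemma pair_mul X Y : pair X Y = \tr ((X * Y) 0). Proof. by []. Qed.

Lemma pairA X Y Z : pair (X * Y) Z = pair X (Y * Z).
Proof. by rewrite !pair_mul mulrA. Qed.

Lemma pairDr X Y Z : pair X (Y + Z) = pair X Y + pair X Z.
Proof. by rewrite !pair_mul mulrDr addlE mxtraceD. Qed.

Lemma pairNr X Y : pair X (- Y) = - pair X Y.
Proof. by rewrite !pair_mul mulrN opplE raddfN. Qed.

Lemma pairBr X Y Z : pair X (Y - Z) = pair X Y - pair X Z.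
Proof. by rewrite pairDr pairNr. Qed.

Lemma pairDl X Y Z : pair (X + Y) Z = pair X Z + pair Y Z.
Proof. by rewrite pairC pairDr !(pairC Z). Qed.

Lemma pairNl X Y : pair (- X) Y = - pair X Y.
Proof. by rewrite pairC pairNr pairC. Qed.

Lemma pair_mono p M X : pair (mono p M) X = \tr (M *m X (- p)).
Proof.
rewrite (@pairE [:: p]) // ?big_seq1 ?monoE ?eqxx // => q.
by rewrite monoE inE; case: ifP; rewrite ?eqxx.
Qed.

Lemma P0E X p : P0 X p = if p == 0 then X p else 0.
Proof. by rewrite fsfunE; case: finsuppP; rewrite ?if_same. Qed.
Lemma PposE X p : Ppos X p = if 0 < p then X p else 0.
Proof. by rewrite fsfunE; case: finsuppP; rewrite ?if_same. Qed.
Lemma PnegE X p : Pneg X p = if p < 0 then X p else 0.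
Proof. by rewrite fsfunE; case: finsuppP; rewrite ?if_same. Qed.

Lemma WmatE (M : 'M[R]_N) i j : Wmat M i j =
  if i == j then \sum_(k < N) (sgz (k%:Z - j%:Z))%:~R * M k k else 0.
Proof. by rewrite mxE. Qed.

Lemma Wmat0 : Wmat (0 : 'M[R]_N) = 0.
Proof.
apply/matrixP=> i j; rewrite WmatE mxE; case: eqP => // _.
by apply: big1 => k _; rewrite mxE mulr0.
Qed.

Lemma WopE X p : Wop X p = if p == 0 then Wmat (X 0) else 0.
Proof.
rewrite fsfunE; case: ifPn => // /loopE Xp; case: eqP => // p0.
by rewrite -p0 Xp Wmat0.
Qed.

Lemma loop_triangular X : X = Ppos X + P0 X + Pneg X.
Proof.
apply/fsfunP=> p; rewrite !addlE PposE P0E PnegE.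
by case: ltgtP; rewrite ?addr0 ?add0r.
Qed.

Lemma loop_entry_triangular X p x y :
  X p x y = Ppos X p x y + P0 X p x y + Pneg X p x y.
Proof. by rewrite {1}(loop_triangular X) !addlE !mxE. Qed.

Lemma pair_Ppos X Y : pair (Ppos X) Y = pair X (Pneg Y).
Proof.
have us := fset_uniq (finsupp X).
rewrite [RHS]pair_suppl (pairE _ us) => [|q].
  apply: eq_bigr => q _; rewrite PposE PnegE oppr_lt0.
  by case: ifP => _; rewrite ?mul0mx ?mulmx0.
by rewrite PposE mem_finsupp; case: ifP; rewrite ?eqxx.
Qed.

Lemma pair_P0 X Y : pair (P0 X) Y = pair X (P0 Y).
Proof.
have us := fset_uniq (finsupp X).
rewrite [RHS]pair_suppl (pairE _ us) => [|q].
  apply: eq_bigr => q _; rewrite !P0E oppr_eq0.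
  by case: ifP => _; rewrite ?mul0mx ?mulmx0.
by rewrite P0E mem_finsupp; case: ifP; rewrite ?eqxx.
Qed.

(** The kernel sgn(k - j) is antisymmetric. *)
Lemma trace_Wmat (M M' : 'M[R]_N) : \tr (Wmat M *m M') = - \tr (M *m Wmat M').
Proof.
have E (A B : 'M[R]_N) : \tr (Wmat A *m B) =
    \sum_(j < N) \sum_(k < N) (sgz (k%:Z - j%:Z))%:~R * A k k * B j j.
  rewrite /mxtrace; apply: eq_bigr => j _; rewrite mxE (bigD1 j) //= WmatE eqxx.
  rewrite [X in _ + X]big1 ?addr0 ?mulr_suml // => k /negPf jk.
  by rewrite WmatE eq_sym jk mul0r.
rewrite (mxtrace_mulC M) !E -sumrN exchange_big; apply: eq_bigr => k _.
rewrite -sumrN; apply: eq_bigr => j _.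
by rewrite -[k%:Z - j%:Z]opprB sgzN rmorphN /= !mulNr mulrAC.
Qed.

Lemma pair_Wop X Y : pair (Wop X) Y = - pair X (Wop Y).
Proof.
have WopE' Z : Wop Z = mono 0 (Wmat (Z 0)).
  by apply/fsfunP=> p; rewrite WopE monoE.
by rewrite (pairC X) !WopE' !pair_mono oppr0 trace_Wmat (mxtrace_mulC (X 0)).
Qed.

Lemma R0E X : R0 X = Ppos X - Pneg X. Proof. by []. Qed.
Lemma A1E X : A1 X = R0 X + Wop X. Proof. by []. Qed.
Lemma A2E X : A2 X = R0 X - Wop X. Proof. by []. Qed.
Lemma SopE X : Sop X = P0 X - Wop X. Proof. by []. Qed.
Lemma SstarE X : Sstar X = P0 X + Wop X. Proof. by []. Qed.

Lemma pair_R0 X Y : pair (R0 X) Y = - pair X (R0 Y).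
Proof.
rewrite !R0E pairBr pairDl pairNl pair_Ppos opprB; congr (_ - _).
by rewrite pairC -pair_Ppos pairC.
Qed.

Lemma pair_A1 X Y : pair (A1 X) Y = - pair X (A1 Y).
Proof. by rewrite !A1E pairDl pairDr pair_R0 pair_Wop opprD. Qed.
Lemma pair_A2 X Y : pair (A2 X) Y = - pair X (A2 Y).
Proof. by rewrite !A2E pairDl pairNl pairBr pair_R0 pair_Wop opprB opprK addrC. Qed.
Lemma pair_Sop X Y : pair (Sop X) Y = pair X (Sstar Y).
Proof. by rewrite SopE SstarE pairDl pairNl pairDr pair_P0 pair_Wop opprK. Qed.
Lemma pair_Sstar X Y : pair (Sstar X) Y = pair X (Sop Y).
Proof. by rewrite pairC -pair_Sop pairC. Qed.

Definition hamD (A B : loop R N) : loop R N :=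
  mono 0 (2^-1 *: (A 0 + B 0 - Wmat (A 0) + Wmat (B 0))).

Lemma hamDD A B : hamD A B + hamD A B = P0 A + P0 B - Wop A + Wop B.
Proof.
apply/fsfunP=> p; rewrite !addlE opplE !P0E !WopE !monoE.
case: eqP => [->|_]; last by rewrite oppr0 !addr0.
by rewrite -scalerDl -[_ + 2^-1]mulr2n -[_ *+ 2]mulr_natl mulfV ?scale1r // pnatr_eq0.
Qed.

(** The field V in its first form, for a function with gradient [G]. *)
Definition hamV L G : loop R N :=
  (Ppos (L * G) + hamD (L * G) (G * L)) * L - L * (Ppos (G * L) + hamD (L * G) (G * L)).

Lemma hamV_neg L G : let A := L * G in let B := G * L in
  hamV L G = (hamD A B - P0 A - Pneg A) * L - L * (hamD A B - P0 B - Pneg B).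
Proof.
move=> A B; rewrite /hamV -/A -/B; set D := hamD A B.
have -> : Ppos A = A - P0 A - Pneg A by rewrite {2}(loop_triangular A) addrAC addrK addrK.
have -> : Ppos B = B - P0 B - Pneg B by rewrite {2}(loop_triangular B) addrAC addrK addrK.
have shuffle (X Y Z : loop R N) : X - Y - Z + D = X + (D - Y - Z).
  by rewrite -!addrA; congr (_ + _); rewrite [RHS]addrCA; congr (_ + _); rewrite addrC.
rewrite !shuffle mulrDl mulrDr /A /B mulrA opprD addrACA subrr add0r //.
Qed.

(** Adjointness moves every operator onto the products of L and G; cyclicity of the form then
    isolates H. *)
Lemma PB2_hamV L H G : PB2 L H G = pair H (hamV L G).
Proof.
set A := L * G; set B := G * L.
have two : (2 : R) != 0 by rewrite pnatr_eq0.
apply: (mulfI two); rewrite [RHS]mulr_natl [RHS]mulr2n -pairDr.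
(* This is 2 V, because R_0 = 2 P_{>0} + P_0 - 1 and the two identity terms cancel by A L = L B. *)
have -> : hamV L G + hamV L G =
   A2 A * L + Sstar B * L - L * A1 B - L * Sop A.
  have E2 : A2 A + Sstar B = Ppos A + Ppos A + (hamD A B + hamD A B) - A.
    apply/fsfunP=> p; apply/matrixP=> x y; rewrite hamDD A2E SstarE R0E.
    by rewrite !(addlE, opplE, mxE) (loop_entry_triangular A); ring.
  have E1 : A1 B + Sop A = Ppos B + Ppos B + (hamD A B + hamD A B) - B.
    apply/fsfunP=> p; apply/matrixP=> x y; rewrite hamDD A1E SopE R0E.
    by rewrite !(addlE, opplE, mxE) (loop_entry_triangular B); ring.
  rewrite -mulrDl -[RHS]addrA -opprD -mulrDr E1 E2 /hamV -/A -/B.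
  have drop_comm (X Y : loop R N) : (X - A) * L - L * (Y - B) = X * L - L * Y.
    by rewrite mulrBl mulrBr opprB addrA /A /B mulrA subrK.
  rewrite drop_comm.
  by rewrite !mulrDl !mulrDr; apply/fsfunP=> p; apply/matrixP=> x y;
     rewrite !(addlE, opplE, mxE); ring.
rewrite /PB2 -[lmul L H]/(L * H) -[lmul H L]/(H * L) -[lmul L G]/A -[lmul G L]/B.
rewrite pair_A1 pair_A2 pair_Sop pair_Sstar !(pairC (L * H)) -!(pairA _ L H) !(pairC _ H).
rewrite (pairBr H _ (L * Sop A)) (pairBr H _ (L * A1 B)) (pairDr H (A2 A * L)) !pairA.
by field.
Qed.

End LoopRing.

(** * The twisted grading and degree bounds for products *)

Section Grading.
Variables (R : numClosedFieldType) (N : nat).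
Implicit Types (X Y Z L G : loop R N) (p q : int) (x y : 'I_N).

Lemma in_gP X : in_g X <->
  forall p x y, X p x y != 0 -> (N%:Z %| x%:Z - y%:Z - p)%Z.
Proof.
split=> gX p x y /gX; first by move/eqP; rewrite eqz_mod_dvd.
by move=> d; apply/eqP; rewrite eqz_mod_dvd.
Qed.

Lemma in_gD X Y : in_g X -> in_g Y -> in_g (X + Y).
Proof.
move=> gX gY p x y; rewrite addlE mxE.
by have [->|/gX //] := eqVneq (X p x y) 0; rewrite add0r; apply: gY.
Qed.

Lemma in_gN X : in_g X -> in_g (- X).
Proof. by move=> gX p x y; rewrite opplE mxE oppr_eq0; apply: gX. Qed.

Lemma in_gM X Y : in_g X -> in_g Y -> in_g (X * Y).
Proof.
move=> /in_gP gX /in_gP gY; apply/in_gP=> p x y.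
apply: contraR => Ndvd; rewrite -[(X * Y) p]/(lmul X Y p) lmul_suppl summxE.
apply/eqP; apply: big1 => q _; rewrite mxE; apply: big1 => z _.
apply/eqP; apply: contraR Ndvd; rewrite mulf_eq0 negb_or => /andP[/gX dX /gY dY].
have -> : x%:Z - y%:Z - p = (x%:Z - z%:Z - q) + (z%:Z - y%:Z - (p - q)) by ring.
exact: rpredD.
Qed.

Lemma in_g_Ppos X : in_g X -> in_g (Ppos X).
Proof.
move=> gX p x y; rewrite PposE.
by case: ifP => _; [apply: gX|rewrite mxE eqxx].
Qed.

(** Indices below N that are congruent modulo N coincide. *)
Lemma in_g_diag X x y : in_g X -> x != y -> X 0 x y = 0.
Proof.
move=> /in_gP gX xy; apply/eqP; apply: contraNT xy => /gX; rewrite subr0.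
rewrite -eqz_mod_dvd !modz_nat !modn_small ?ltn_ord //.
Qed.

Lemma in_g_mono p (M : 'M[R]_N) :
  (forall x y, M x y != 0 -> (N%:Z %| x%:Z - y%:Z - p)%Z) -> in_g (mono p M).
Proof.
move=> dM; apply/in_gP=> q x y; rewrite monoE; case: (q =P p) => [->|_]; first exact: dM.
by rewrite mxE eqxx.
Qed.

Lemma hamD_offdiag X Y x y : in_g X -> in_g Y -> x != y -> hamD X Y 0 x y = 0.
Proof.
move=> gX gY xy; rewrite monoE eqxx !mxE (negPf xy) !in_g_diag //.
by rewrite !addr0 oppr0 addr0 mulr0.
Qed.

Lemma in_g_hamD X Y : in_g X -> in_g Y -> in_g (hamD X Y).
Proof.
move=> gX gY; apply: in_g_mono => x y; have [-> _|xy] := eqVneq x y.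
  by rewrite subr0 subrr.
have := hamD_offdiag gX gY xy; rewrite monoE eqxx => ->.
by rewrite eqxx.
Qed.

Lemma in_g_hamV L G : in_g L -> in_g G -> in_g (hamV L G).
Proof.
move=> gL gG; have gA := in_gM gL gG; have gB := in_gM gG gL.
have gD := in_g_hamD gA gB.
have gAD := in_gD (in_g_Ppos gA) gD; have gBD := in_gD (in_g_Ppos gB) gD.
exact: (in_gD (in_gM gAD gL) (in_gN (in_gM gL gBD))).
Qed.

Lemma lmul_low (c d : int) X Y p : (forall q, q < c -> X q = 0) ->
  (forall q, q < d -> Y q = 0) -> p < c + d -> (X * Y) p = 0.
Proof.
move=> lX lY pcd; rewrite -[(X * Y) p]/(lmul X Y p) lmul_suppl big1 // => q _.
have [/lX->|cq] := ltP q c; first by rewrite mul0mx.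
by rewrite lY ?mulmx0 //; lia.
Qed.

Lemma lmul_high (c d : int) X Y p : (forall q, c < q -> X q = 0) ->
  (forall q, d < q -> Y q = 0) -> c + d < p -> (X * Y) p = 0.
Proof.
move=> lX lY pcd; rewrite -[(X * Y) p]/(lmul X Y p) lmul_suppl big1 // => q _.
have [/lX->|cq] := ltP c q; first by rewrite mul0mx.
by rewrite lY ?mulmx0 //; lia.
Qed.

(** Under these bounds only the pair of degrees c and d can add up to c + d. *)
Lemma lmul_top (c d : int) X Y : (forall q, c < q -> X q = 0) ->
  (forall q, d < q -> Y q = 0) -> (X * Y) (c + d) = X c *m Y d.
Proof.
move=> lX lY; rewrite -[(X * Y) _]/(lmul X Y _) lmul_suppl.
have offc q : q != c -> X q *m Y (c + d - q) = 0.
  rewrite neq_lt => /orP[qc|/lX->]; last by rewrite mul0mx.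
  by rewrite lY ?mulmx0 //; lia.
have Ed : c + d - c = d by ring.
have [cX|/loopE Xc] := boolP (c \in finsupp X).
  rewrite (big_rem c) //= Ed big_seq big1 ?addr0 // => q.
  by rewrite (mem_rem_uniq _ (fset_uniq _)) inE => /andP[/offc].
rewrite Xc mul0mx big1 // => q _.
by have [->|/offc//] := eqVneq q c; rewrite Xc mul0mx.
Qed.

Lemma mul_mono (M : 'M[R]_N) X q p : (X * mono q M) p = X (p - q) *m M.
Proof.
rewrite -[LHS]/(lmul _ _ p) (@lmulEr _ _ [:: q]) // ?big_seq1.
  by rewrite monoE eqxx.
by move=> r; rewrite monoE inE; case: ifP; rewrite ?eqxx.
Qed.

Lemma mono_mul (M : 'M[R]_N) X q p : (mono q M * X) p = M *m X (p - q).
Proof.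
rewrite -[LHS]/(lmul _ _ p) (@lmulE _ _ [:: q]) // ?big_seq1.
  by rewrite monoE eqxx.
by move=> r; rewrite monoE inE; case: ifP; rewrite ?eqxx.
Qed.

Lemma trace_comm L G : \tr ((L * G) 0) = \tr ((G * L) 0).
Proof. by rewrite -!pair_mul pairC. Qed.

End Grading.

(** * Hamiltonian fields are tangent to T_{m+1} *)

Section Lattice.
Variables (R : numClosedFieldType) (n : nat).
Local Notation N := n.+1.
Implicit Types (X Y Z L G H : loop R N) (p q : int) (x y z : 'I_N).

(** Moving one site along the cycle, the kernel of W jumps only at the two sites involved; passing
    from the last site n back to 0 adds the constant 2 for every z. *)
Lemma sgz_step x y z : (x : nat) = (y.+1 %% N)%N ->
  (sgz (z%:Z - x%:Z))%:~R - (sgz (z%:Z - y%:Z))%:~R =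
  ((val y == n)%:R *+ 2 - (z == x)%:R - (z == y)%:R : R).
Proof.
move=> xE.
have -> : (z == x) = (val z == val x) by [].
have -> : (z == y) = (val z == val y) by [].
have zN := ltn_ord z; have yN := ltn_ord y.
have E : (sgz (z%:Z - x%:Z)) - (sgz (z%:Z - y%:Z)) =
   (val y == n)%:R *+ 2 - (val z == val x)%:R - (val z == val y)%:R :> int.
  have [yn|yn] := eqVneq (val y) n.
    by rewrite yn modnn in xE; rewrite /= in yn *; lia.
  rewrite modn_small in xE; last by rewrite /= in yn *; lia.
  by rewrite /= in yn *; lia.
rewrite -rmorphB /= E !rmorphB /= rmorphMn /=.
by rewrite !natz !pmulrn.
Qed.


(** The wrap-around contributes a multiple of the trace, which disappears from differences of
    matrices with equal trace. *)
Lemma Wmat_step (M : 'M[R]_N) x y : (x : nat) = (y.+1 %% N)%N ->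
  Wmat M x x = Wmat M y y + (val y == n)%:R *+ 2 * \tr M - M x x - M y y.
Proof.
move=> xy.
have pick w : \sum_z (z == w)%:R * M z z = M w w.
  rewrite (bigD1 w) //= eqxx mul1r big1 ?addr0 // => z /negPf->.
  by rewrite mul0r.
have E : Wmat M x x - Wmat M y y = (val y == n)%:R *+ 2 * \tr M - M x x - M y y.
  rewrite !WmatE !eqxx -sumrB.
  under eq_bigr do rewrite -mulrBl (sgz_step _ xy) !mulrBl.
  by rewrite !sumrB -mulr_sumr !pick.
by rewrite -(subrK (Wmat M y y) (Wmat M x x)) E; ring.
Qed.

Lemma hamDE X Y x y : hamD X Y 0 x y =
  2^-1 * (X 0 x y + Y 0 x y - Wmat (X 0) x y + Wmat (Y 0) x y).
Proof. by rewrite monoE eqxx; move: (Wmat _) (Wmat _) => U V; rewrite !mxE. Qed.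

Local Notation o := (fun k : nat => inZp k : 'I_N).

Lemma ent_inZp (M : 'M[R]_N) i j : ent M i j = M (o i) (o j).
Proof.
have lt k : (k %% N < N)%N by rewrite ltn_pmod.
rewrite /ent (insubT (fun k => k < N)%N (lt i)) (insubT (fun k => k < N)%N (lt j)).
by congr (M _ _); apply: val_inj.
Qed.

Lemma inZpK x : o x = x.
Proof. by apply/val_inj; rewrite /= modn_small. Qed.

(** Writing the degree as a difference of naturals turns the integer congruence of the grading into
    one without subtraction. *)
Lemma dvdz_inZp (i j : nat) (r : int) (s t : nat) : r = s%:Z - t%:Z ->
  (N%:Z %| (o i)%:Z - (o j)%:Z - r)%Z = (i + t == j + s %[mod N])%N.
Proof.
move=> ->; have -> : (o i)%:Z - (o j)%:Z - (s%:Z - t%:Z) =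
  ((i %% N)%N + t)%:Z - ((j %% N)%N + s)%:Z by rewrite /= !PoszD; ring.
by rewrite -eqz_mod_dvd !modz_nat eqz_nat !modnDml.
Qed.

Section OnT.
Variables (m : nat) (L : loop R N).
Hypothesis LT : inT m L.

Lemma inT_gt1 p : 1 < p -> L p = 0.
Proof.
case: LT => b [a ->] p1; rewrite /Ecoef /Dcoef.
by rewrite gt_eqF // gt_eqF ?(lt_trans _ p1) // lt_gtF ?addr0 // (lt_trans _ p1).
Qed.

Lemma inT_low p : p < - m%:Z -> L p = 0.
Proof.
case: LT => b [a ->] pm; rewrite /Ecoef /Dcoef.
rewrite !ifF ?addr0 //; lia.
Qed.

Lemma inT_1 x y : L 1 x y = ((x : nat) == (y.+1 %% N)%N)%:R.
Proof. by case: LT => b [a ->]; rewrite /Ecoef /Dcoef /= addr0 mxE. Qed.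

Lemma inT_in_g : in_g L.
Proof.
case: LT => b [a LE]; apply/in_gP=> p x y; rewrite LE /Ecoef /Dcoef.
have dvdE (s t : nat) : p = s%:Z - t%:Z -> (x + t)%N = y + s %[mod N] ->
    (N%:Z %| x%:Z - y%:Z - p)%Z.
  by move=> pE /eqP E; rewrite -(inZpK x) -(inZpK y) (dvdz_inZp _ _ pE).
case: (p =P 1) => [p1|_].
  rewrite p1 /= addr0 mxE; case: ((x : nat) =P _) => [xE _|_]; last by rewrite eqxx.
  by rewrite -p1; apply: (dvdE 1%N 0%N); rewrite ?p1 // xE addn0 modn_mod addn1.
rewrite add0r; case: (p =P 0) => [->|_].
  rewrite mxE; case: (x =P y) => [->|_]; first by rewrite subr0 subrr dvdz0.
  by rewrite mul0r eqxx.
case: ifP => [/andP[p0 _]|_]; last by rewrite mxE eqxx.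
rewrite mxE; case: ((y : nat) =P _) => [yE _|_]; last by rewrite mul0r eqxx.
by apply: (dvdE 0%N `|p|%N); [lia|rewrite yE addn0 modn_mod].
Qed.

Lemma hamV_low G p : p < - m%:Z -> hamV L G p = 0.
Proof.
move=> pm; set A := L * G; set B := G * L.
have low (X : loop R N) : forall q, q < 0 -> (Ppos X + hamD A B) q = 0.
  by move=> q q0; rewrite addlE PposE monoE lt_gtF // lt_eqF // addr0.
rewrite /hamV -/A -/B addlE opplE.
rewrite (lmul_low (low A) inT_low) ?add0r // (lmul_low inT_low (low B)) ?addr0 //.
by rewrite oppr0.
Qed.

Lemma hamV_gt0 G p : in_g G -> 0 < p -> hamV L G p = 0.
Proof.
move=> gG p0; set A := L * G; set B := G * L.
have gA : in_g A := in_gM inT_in_g gG.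
have gB : in_g B := in_gM gG inT_in_g.
have high (X : loop R N) : forall q, 0 < q -> (hamD A B - P0 X - Pneg X) q = 0.
  move=> q q0; rewrite !addlE !opplE P0E PnegE monoE lt_gtF // gt_eqF //.
  by rewrite oppr0 !addr0.
have val0 (X : loop R N) : (hamD A B - P0 X - Pneg X) 0 = hamD A B 0 - X 0.
  by rewrite !addlE !opplE P0E PnegE ltxx oppr0 addr0.
rewrite hamV_neg -/A -/B addlE opplE.
have [p1|p1] := ltP 1 p.
  rewrite (lmul_high (high A) inT_gt1) ?add0r // (lmul_high inT_gt1 (high B)) ?addr0 //.
  by rewrite oppr0.
(* Degree 1 is the sum of the top degrees 0 and 1, so only the diagonal matrices D - A_0 and D - B_0
   and the shift matrix enter. *)
have -> : p = 0 + 1 by lia.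
rewrite (lmul_top (high A) inT_gt1) [0 + 1]addrC (lmul_top inT_gt1 (high B)) !val0.
have off (X : loop R N) x y : in_g X -> x != y -> (hamD A B 0 - X 0) x y = 0.
  by move=> gX xy; rewrite !mxE hamD_offdiag // in_g_diag // subr0.
apply/matrixP=> x y; rewrite !mxE (bigD1 x) //= [X in _ + X - _]big1 ?addr0; last first.
  by move=> z zx; rewrite off ?mul0r // eq_sym.
rewrite [X in _ - X](bigD1 y) //= [X in _ - (_ + X)]big1 ?addr0; last first.
  by move=> z zy; rewrite off ?mulr0.
rewrite inT_1; case: ((x : nat) =P _) => [xy|_]; last by rewrite mul0r mulr0 subrr.
have trAB : \tr (A 0) = \tr (B 0) by exact: trace_comm.
have entB (U V : 'M[R]_N) z : (U - V) z z = U z z - V z z by rewrite !mxE.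
(* Here x is the cyclic successor of y; as A_0 and B_0 have the same trace, the wrap-around terms
   cancel. *)
rewrite mulr1 mul1r !entB !hamDE !(Wmat_step _ xy) trAB.
by field.
Qed.

Lemma hamV_tangent G : in_g G -> tangentT m (hamV L G).
Proof.
move=> gG; have gV := in_g_hamV inT_in_g gG.
set V := hamV L G in gV *.
(* The coordinates are read off the entries of V; all other entries vanish by the grading or by one
   of the two degree bounds. *)
exists (fun i => V 0 (o i) (o i)), (fun q i : nat => V (- q%:Z) (o i) (o (i + q)%N)) => p.
rewrite /Dcoef; case: (p =P 0) => [->|p0].
  apply/matrixP=> x y; rewrite mxE /= inZpK; case: (x =P y) => [->|/eqP xy].
    by rewrite mul1r.
  by rewrite mul0r in_g_diag.
case: ifP => [/andP[plt pm]|].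
  have pE : p = - `|p|%N%:Z by lia.
  apply/matrixP=> x y; rewrite mxE /= -pE inZpK.
  case: ((y : nat) =P _) => [yE|yN].
    by rewrite mul1r; rewrite (_ : inZp _ = y) //; apply: val_inj.
  rewrite mul0r; apply/eqP; apply/negPn/negP => /(gV p x y) /eqP.
  rewrite eqz_mod_dvd -(inZpK x) -(inZpK y) (@dvdz_inZp _ _ p 0 `|p|%N); last by lia.
  by rewrite addn0 (modn_small (ltn_ord y)) => /eqP /esym.
move=> pout; have [/hamV_gt0-> //|ple] := ltP 0 p.
by apply: hamV_low; lia.
Qed.

End OnT.
End Lattice.

(** * Uniqueness of derivatives and nondegeneracy of the form *)

Lemma poly_ext (R : numDomainType) (P Q : {poly R}) :
  (forall e, P.[e] = Q.[e]) -> P = Q.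
Proof.
move=> PQ; apply/eqP; rewrite -subr_eq0; apply: contraT => nz.
(* A nonzero difference would have as many roots 0, 1, 2, ... as its size, one more than its degree;
   they are distinct in characteristic 0. *)
pose rs := [seq i%:R : R | i <- iota 0 (size (P - Q))].
have := max_poly_roots nz (rs := rs); rewrite size_map size_iota ltnn; apply.
  by apply/allP => e _; rewrite /root hornerD hornerN PQ subrr.
rewrite map_inj_in_uniq ?iota_uniq // => i j _ _ /eqP.
by rewrite eqr_nat => /eqP.
Qed.

(** [deriv_at0] asks only for some polynomial, but its values at all points determine it. *)
Lemma deriv_at0_unique (R : numClosedFieldType) (f : R -> R) d d' :
  deriv_at0 f d -> deriv_at0 f d' -> d = d'.
Proof.
move=> [P [fP <-]] [Q [fQ <-]]; congr (_^`().[_]).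
by apply: poly_ext => e; rewrite -fP.
Qed.

Lemma deriv_at0_affine (R : numClosedFieldType) (f : R -> R) (c d : R) :
  (forall e, f e = c + e * d) -> deriv_at0 f d.
Proof.
move=> fE; exists (c%:P + d *: 'X); split=> [e|]; first by rewrite fE !hornerE mulrC.
by rewrite derivD derivC derivZ derivX !hornerE.
Qed.

Lemma trace_delta_mul (R : comPzRingType) n (x y : 'I_n) (M : 'M[R]_n) :
  \tr (delta_mx x y *m M) = M y x.
Proof.
rewrite mxtrace_mulC /mxtrace (bigD1 y) //= !mxE (bigD1 x) //= !mxE !eqxx mulr1.
rewrite big1 => [|z /negPf zx]; last by rewrite !mxE zx mulr0.
rewrite addr0 big1 ?addr0 // => z /negPf zy; rewrite !mxE big1 // => w _.
by rewrite !mxE zy andbF mulr0.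
Qed.

(** The entry [X p x y] is the pairing of X with lambda^(-p) E_{yx}, a test element that lies in g
    whenever this entry is nonzero. *)
Lemma pair_nondegenerate (R : numClosedFieldType) N (X : loop R N) :
  in_g X -> (forall M, in_g M -> pair X M = 0) -> X = 0.
Proof.
move=> gX X0; apply/fsfunP=> p; apply/matrixP=> x y; rewrite zerolE mxE.
apply/eqP/contraT => nz; case/negP: (nz); apply/eqP.
rewrite -trace_delta_mul -[p]opprK -pair_mono pairC; apply: X0.
apply: in_g_mono => a b; rewrite mxE.
case: andP => [[/eqP-> /eqP->] _|_]; last by rewrite eqxx.
move/in_gP: gX => /(_ p x y nz); rewrite -rpredN.
by have -> : - (x%:Z - y%:Z - p) = y%:Z - x%:Z - - p by ring.
Qed.

Lemma mulmx_delta (R : pzSemiRingType) n (M : 'M[R]_n) (c d x y : 'I_n) :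
  (M *m delta_mx c d) x y = M x c * (y == d)%:R.
Proof.
rewrite !mxE (bigD1 c) //= !mxE eqxx big1 ?addr0 // => z /negPf zc.
by rewrite mxE zc mulr0.
Qed.

Lemma delta_mulmx (R : pzSemiRingType) n (M : 'M[R]_n) (c d x y : 'I_n) :
  (delta_mx c d *m M) x y = (x == c)%:R * M d y.
Proof.
rewrite !mxE (bigD1 d) //= !mxE eqxx andbT big1 ?addr0 // => z /negPf zd.
by rewrite mxE zd andbF mul0r.
Qed.

Lemma mulmx_delta_mul (R : pzSemiRingType) n (M M' : 'M[R]_n) (c d x y : 'I_n) :
  (M *m delta_mx c d *m M') x y = M x c * M' d y.
Proof.
rewrite mxE (bigD1 d) //= mulmx_delta eqxx mulr1 big1 ?addr0 // => z /negPf zd.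
by rewrite mulmx_delta zd mulr0 mul0r.
Qed.

(** * Coordinate functions and their gradients *)

Section Coordinates.
Variables (R : numClosedFieldType) (n : nat).
Local Notation N := n.+1.
Implicit Types (X L G H : loop R N) (i j k l : nat).
Local Notation o := (fun k : nat => inZp k : 'I_N).

(** The value i = 0 stands for b_k, so that both kinds of coordinates are treated together. *)
Definition is_coord i k (phi : loop R N -> R) :=
  forall X, phi X = X (- i%:Z) (o k) (o (k + i)%N).

Definition coord_grad i k : loop R N := mono i%:Z (delta_mx (o (k + i)%N) (o k)).

Lemma pair_coord_grad i k X : pair (coord_grad i k) X = X (- i%:Z) (o k) (o (k + i)%N).
Proof. by rewrite pair_mono trace_delta_mul. Qed.

Lemma is_grad_coord i k phi L : is_coord i k phi -> is_grad phi L (coord_grad i k).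
Proof.
move=> phiE; split.
  apply: in_g_mono => a b; rewrite mxE.
  case: andP => [[/eqP-> /eqP->] _|_]; last by rewrite eqxx.
  by rewrite (@dvdz_inZp _ _ _ _ i 0) ?subr0 // addn0.
move=> M _; apply: (@deriv_at0_affine _ _ (phi L)) => e.
by rewrite phiE laddE lscaleE !mxE phiE pair_coord_grad.
Qed.

(** Nondegeneracy on g reduces the universal clause of [PBval] to one explicit pair of gradients. *)
Lemma is_grad_unique phi L G H : is_grad phi L G -> is_grad phi L H -> G = H.
Proof.
move=> [gG dG] [gH dH]; apply/eqP; rewrite -subr_eq0; apply/eqP.
apply: pair_nondegenerate => [|M gM]; first by exact: in_gD gG (in_gN gH).
by rewrite pairDl pairNl (deriv_at0_unique (dG M gM) (dH M gM)) subrr.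
Qed.

(** Since the bracket is the pairing of grad phi with the field V of psi, it is a single entry of
    V. *)
Lemma PBval_coord i k j l phi psi L v : is_coord i k phi -> is_coord j l psi ->
  hamV L (coord_grad j l) (- i%:Z) (o k) (o (k + i)%N) = v -> PBval phi psi L v.
Proof.
move=> phiE psiE <-; have gG := is_grad_coord L phiE; have gH := is_grad_coord L psiE.
split=> [|G H dG dH]; first by exists (coord_grad i k), (coord_grad j l).
rewrite (is_grad_unique dG gG) (is_grad_unique dH gH).
by rewrite PB2_hamV pair_coord_grad.
Qed.

End Coordinates.

(** * A closed formula for the coordinate brackets *)

Section Bracket.
Variables (R : numClosedFieldType) (n m : nat) (L : loop R n.+1).
Local Notation N := n.+1.
Local Notation o := (fun k : nat => inZp k : 'I_N).
Hypothesis LT : inT m L.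
Implicit Types i j k l s t : nat.
Local Notation a := (fun t k => aconv m t k L).

(* [ahat t k] is a_k^(t-1), where a_k^(-1) = 1 is the coefficient of lambda E_{k,k-1}. *)
Definition ahat t k : R := if t is t'.+1 then a t' k else 1.

Lemma aconv_gt t k : (m < t)%N -> a t k = 0.
Proof. by rewrite /aconv; case: t => // t; rewrite ltnNge /= => /negPf ->. Qed.

Lemma aconv_mod t k k' : k = k' %[mod N] -> a t k = a t k'.
Proof.
move=> kk; have ok : o k = o k' by apply: val_inj.
have okt : o (k + t)%N = o (k' + t)%N.
  by apply: val_inj => /=; rewrite -modnDml kk modnDml.
by rewrite /aconv /bcoord /acoord !ent_inZp ok okt.
Qed.

(** The convention a^(t) = 0 for t > m agrees with L having no degree below -m. *)
Lemma aconvE t k : a t k = L (- t%:Z) (o k) (o (k + t)%N).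
Proof.
rewrite /aconv /bcoord /acoord !ent_inZp.
case: eqP => [->|_]; first by rewrite addn0 oppr0.
by case: leqP => // mt; rewrite (inT_low LT) ?mxE //; lia.
Qed.

(** One formula covers every coefficient, the shift being t = 0; the 1 added to l avoids a
    subtraction. *)
Lemma inT_entry p t k l : p = 1 - t%:Z ->
  L p (o k) (o l) = (l + 1 == k + t %[mod N])%N%:R * ahat t k.
Proof.
move=> ->; case: t => [|t].
  by rewrite subr0 (inT_1 LT) /= mulr1 addn0 addn1 eq_sym -(addn1 (l %% N)) modnDml addn1.
have -> : 1 - t.+1%:Z = - t%:Z by lia.
rewrite /= aconvE addn1 addnS -(addn1 l) -(addn1 (k + t)%N) eqn_modDr.
case: eqP => [E|NE]; first by rewrite mul1r; congr (L _ _ _); apply: val_inj.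
rewrite mul0r; apply/eqP/contraT => /(inT_in_g LT) /eqP.
rewrite eqz_mod_dvd (@dvdz_inZp _ _ _ _ 0 t); last by lia.
by rewrite addn0 eq_sym => /eqP.
Qed.


(** The three parts come from P_{>0}(A) L, from L P_{>0}(B) and from D L - L D. In the first two, s
    is the degree of the term of A or B; in the last, l + s runs through the cyclic interval
    [l, l+j]. *)
Definition bracket i k j l : R :=
  \sum_(1 <= s < j.+2) (k == l + s %[mod N])%N%:R * (ahat (j.+1 - s) k * a (i + s)%N l)
  - \sum_(1 <= s < j.+2)
      (l + j == k + i + s %[mod N])%N%:R * (a (i + s)%N k * ahat (j.+1 - s) l)
  + a i k * a j l *
    \sum_(0 <= s < j.+1) ((k == l + s %[mod N])%N%:R - (k + i == l + s %[mod N])%N%:R).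

(* The diagonal of [hamD] at the gradient of a_l^(j), divided by a_l^(j). *)
Let half_sgn j l (x : 'I_N) : R := 2^-1 * ((x == o l)%:R + (x == o (l + j)%N)%:R
   - (sgz ((o l)%:Z - x%:Z))%:~R + (sgz ((o (l + j)%N)%:Z - x%:Z))%:~R).

(** By induction on j: one more site adds its indicator up to a constant independent of x, and
    constants cancel in the difference. *)
Lemma half_sgn_diff j l (x y : 'I_N) : half_sgn j l x - half_sgn j l y =
  \sum_(0 <= s < j.+1) ((x == o (l + s)%N)%:R - (y == o (l + s)%N)%:R).
Proof.
elim: j => [|j IH].
  by rewrite big_nat1 /half_sgn addn0; field.
rewrite big_nat_recr //= -IH addnS.
have step (z : 'I_N) : half_sgn j.+1 l z - half_sgn j l z =
    (z == o (l + j).+1)%:R - (val (o (l + j)%N) == n)%:R.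
  have xE : (o (l + j).+1 : nat) = ((o (l + j)%N).+1 %% N)%N.
    by rewrite /= -(addn1 ((l + j) %% N)) modnDml addn1.
  have sgzB (u v : int) : sgz (u - v) = - sgz (v - u) by rewrite -opprB sgzN.
  have := @sgz_step R n _ _ z xE; rewrite !(sgzB z%:Z) !rmorphN /= => E.
  rewrite /half_sgn addnS.
  have {}E : (sgz ((o (l + j).+1)%:Z - z%:Z))%:~R = (sgz ((o (l + j)%N)%:Z - z%:Z))%:~R
    - ((val (o (l + j)%N) == n)%:R *+ 2 - (z == o (l + j).+1)%:R
       - (z == o (l + j)%N)%:R) :> R.
    by rewrite -E; ring.
  by rewrite E; field.
have := step x; have := step y => /(canRL (subrK _)) -> /(canRL (subrK _)) ->.
ring.
Qed.

(** The diagonals of A_0 and B_0 vanish except for an entry a_l^(j), at l for A_0 and at l+j for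
    B_0. *)
Lemma hamD_coord j l (x : 'I_N) :
  hamD (L * coord_grad R n j l) (coord_grad R n j l * L) 0 x x =
  a j l * half_sgn j l x.
Proof.
have AE (z : 'I_N) : (L * coord_grad R n j l) 0 z z = a j l * (z == o l)%:R.
  rewrite mul_mono sub0r mulmx_delta aconvE.
  by case: eqP => [->|_]; rewrite ?mulr0.
have BE (z : 'I_N) : (coord_grad R n j l * L) 0 z z = a j l * (z == o (l + j)%N)%:R.
  rewrite mono_mul sub0r delta_mulmx aconvE mulrC.
  by case: eqP => [->|_]; rewrite ?mulr0.
have pick (w : 'I_N) (F : 'I_N -> R) : \sum_z F z * (a j l * (z == w)%:R) = a j l * F w.
  rewrite (bigD1 w) //= eqxx mulr1 big1 ?addr0 1?mulrC // => z /negPf->.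
  by rewrite !mulr0.
rewrite hamDE !WmatE eqxx AE BE.
under eq_bigr do rewrite AE.
rewrite pick.
under eq_bigr do rewrite BE.
rewrite pick /half_sgn.
by field.
Qed.

Lemma hamV_coord i k j l :
  hamV L (coord_grad R n j l) (- i%:Z) (o k) (o (k + i)%N) = bracket i k j l.
Proof.
set A := L * coord_grad R n j l; set B := coord_grad R n j l * L.
have D0E : hamD A B 0 = 2^-1 *: (A 0 + B 0 - Wmat (A 0) + Wmat (B 0)).
  by rewrite monoE eqxx.
have DL p : (hamD A B * L) p = hamD A B 0 *m L p by rewrite D0E mono_mul subr0.
have LD p : (L * hamD A B) p = L p *m hamD A B 0 by rewrite D0E mul_mono subr0.
rewrite /hamV -/A -/B mulrDl mulrDr opprD addrACA !addlE !opplE DL LD.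
(* As L has degree at most 1 and the gradient has degree j, only the degrees 1 to j+1 survive under
   P_{>0}. *)
have supp (X : loop R N) : (forall q, 1 + j%:Z < q -> X q = 0) ->
    forall q, Ppos X q != 0 -> q \in [seq s%:Z | s <- index_iota 1 j.+2].
  move=> Xhigh q; rewrite PposE; case: ifP => [q0|]; last by rewrite eqxx.
  have [/Xhigh->|qj _] := ltP (1 + j%:Z) q; first by rewrite eqxx.
  by apply/mapP; exists `|q|%N; rewrite ?mem_index_iota; lia.
have us : uniq [seq s%:Z | s <- index_iota 1 j.+2].
  by rewrite map_inj_uniq ?iota_uniq // => s t [].
have Ahigh q : 1 + j%:Z < q -> A q = 0.
  by move=> qj; rewrite mul_mono (inT_gt1 LT) ?mul0mx //; lia.
have Bhigh q : 1 + j%:Z < q -> B q = 0.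
  by move=> qj; rewrite mono_mul (inT_gt1 LT) ?mulmx0 //; lia.
rewrite -[(Ppos A * L) _]/(lmul _ _ _) -[(L * Ppos B) _]/(lmul _ _ _).
rewrite (lmulE _ _ us (supp _ Ahigh)) (lmulEr _ _ us (supp _ Bhigh)) !big_map.
have entB (U V : 'M[R]_N) x y : (U - V) x y = U x y - V x y by rewrite !mxE.
have entD (U V : 'M[R]_N) x y : (U + V) x y = U x y + V x y by rewrite !mxE.
rewrite entD !entB !summxE /bracket; congr (_ - _ + _).
- rewrite big_nat [RHS]big_nat; apply: eq_bigr => s /andP[s1 sj].
  rewrite PposE ltz_nat s1 mul_mono mulmx_delta_mul.
  rewrite (@inT_entry _ (j.+1 - s)); last by lia.
  rewrite (@inT_entry _ (i + s).+1); last by lia.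
  (* Adding s removes the truncated subtraction j+1-s; both entries of L then impose the same
     congruence k = l + s. *)
  rewrite -(eqn_modDr s) -[X in (_ == X %[mod _])%N]addnA subnK; last by lia.
  have -> : (l + j + 1 + s = l + s + j.+1)%N by lia.
  have -> : (k + i + 1 = k + i.+1)%N by lia.
  have -> : (l + (i + s).+1 = l + s + i.+1)%N by lia.
  rewrite !eqn_modDr (eq_sym _ (k %% N)%N).
  by case: eqP; rewrite ?mul0r // !mul1r.
- rewrite big_nat [RHS]big_nat; apply: eq_bigr => s /andP[s1 sj].
  rewrite PposE ltz_nat s1 mono_mul mulmxA mulmx_delta_mul.
  rewrite (@inT_entry _ (i + s).+1); last by lia.
  rewrite (@inT_entry _ (j.+1 - s)); last by lia.
  have -> : (k + i + 1 == l + (j.+1 - s) %[mod N])%N = (l + j == k + i + s %[mod N])%N.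
    rewrite -(eqn_modDr s).
    have -> : (k + i + 1 + s = k + i + s + 1)%N by lia.
    have -> : (l + (j.+1 - s) + s = l + j + 1)%N by lia.
    by rewrite eqn_modDr eq_sym.
  have -> : (k + (i + s).+1 = k + i + s + 1)%N by lia.
  by rewrite eqn_modDr; case: eqP; rewrite ?mul0r // !mul1r.
have Doff (x y : 'I_N) : x != y -> hamD A B 0 x y = 0.
  move=> xy; have gG : in_g (coord_grad R n j l).
    pose phi (X : loop R N) := X (- j%:Z) (o l) (o (l + j)%N).
    by have [] := @is_grad_coord R n j l phi L (fun=> erefl).
  exact: hamD_offdiag (in_gM (inT_in_g LT) gG) (in_gM gG (inT_in_g LT)) xy.
(* D is diagonal, so only its entries at k and k+i act on this entry of L. *)
rewrite !mxE (bigD1 (o k)) //= big1 ?addr0; last first.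
  by move=> z zk; rewrite Doff ?mul0r // eq_sym.
rewrite (bigD1 (o (k + i)%N)) //= big1 ?addr0; last first.
  by move=> z zk; rewrite Doff ?mulr0.
have := half_sgn_diff j l (o k) (o (k + i)%N) => /= <-.
by rewrite !hamD_coord -aconvE; ring.
Qed.

End Bracket.

(** * Evaluation of the sums for N >= 2m+2 *)

Lemma sum_pick (R : pzSemiRingType) a b t (P : nat -> bool) (F : nat -> R) :
  (forall s, (a <= s < b)%N -> P s = (s == t)) ->
  \sum_(a <= s < b) (P s)%:R * F s = (a <= t < b)%N%:R * F t.
Proof.
move=> PE; rewrite big_nat; under eq_bigr => s /PE -> do [].
rewrite -big_nat; have [tab|/negPf tab] := boolP (a <= t < b)%N; last first.
  rewrite mul0r big_nat big1 // => s sab; case: eqP => [E|_]; last by rewrite mul0r.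
  by rewrite -E sab in tab.
rewrite (bigD1_seq t) ?mem_index_iota ?iota_uniq //= eqxx big1 ?addr0 // => s /negPf ->.
by rewrite mul0r.
Qed.

(** Below 2N at most one wrap-around is possible, so congruences become linear conditions. *)
Lemma eqmod_lt2 N x y : (x < 2 * N)%N -> (y < 2 * N)%N ->
  (x == y %[mod N]) = [|| x == y, x == (y + N)%N | y == (x + N)%N].
Proof.
have modE z : (z < 2 * N)%N -> (z %% N)%N = if (z < N)%N then z else (z - N)%N.
  move=> z2; case: ltnP => [/modn_small //|Nz].
  by rewrite -{1}(subnK Nz) modnDr modn_small //; lia.
by move=> xN yN; rewrite !modE //; do 2 case: ltnP => ?; lia.
Qed.

Section BracketValues.
Variables (R : numClosedFieldType) (n m : nat) (L : loop R n.+1).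
Local Notation N := n.+1.
Hypothesis mN : (2 * m + 2 <= N)%N.
Local Notation a := (fun t k => aconv m t k L).
Variables i k j l d : nat.
Hypotheses (im : (i <= m)%N) (jm : (j <= m)%N) (lE : l = k + d %[mod N]) (dN : (d < N)%N).

(* The only values of s that contribute to the sums in [bracket]: e and t to the
   first and second sum, u and v to the positive and negative part of the third. *)
Let e := (N - d)%N.
Let t := (if i + N < d + j then d + j - i - N else d + j - i)%N.
Let u := (if d == 0 then 0 else N - d)%N.
Let v := (if d <= i then i - d else i + N - d)%N.

(** Cancelling k leaves congruences in d, each with at most one solution in range by the bound on N.
    If the subtraction in [t] is truncated, then t = 0 and the term is discarded by 0 < t. Unlike
    [e], [u] treats d = 0 apart because the last sum starts at s = 0. *)
Lemma bracketE : bracket m L i k j l =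
  (0 < e < j.+2)%N%:R * (ahat m L (j.+1 - e) k * a (i + e)%N l)
  - (0 < t < j.+2)%N%:R * (a (i + t)%N k * ahat m L (j.+1 - t) l)
  + a i k * a j l * ((u < j.+1)%N%:R - (v < j.+1)%N%:R).
Proof.
have shift c s : (k + c == l + s %[mod N])%N = (c == d + s %[mod N])%N.
  by rewrite -(modnDml l) lE modnDml -addnA eqn_modDl.
have shift' s : (l + j == k + i + s %[mod N])%N = (d + j == i + s %[mod N])%N.
  by rewrite -(modnDml l) lE modnDml -!addnA eqn_modDl.
have shift0 s : (k == l + s %[mod N])%N = (0 == d + s %[mod N])%N.
  by rewrite -{1}(addn0 k) shift.
rewrite /bracket; congr (_ - _ + _ * _).
- by apply: sum_pick => s sj; rewrite shift0 eqmod_lt2; lia.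
- by apply: sum_pick => s sj; rewrite shift' eqmod_lt2 /t; try case: ifP => ?; lia.
rewrite sumrB.
have pick1 w (P : nat -> bool) : (forall s, (0 <= s < j.+1)%N -> P s = (s == w)) ->
    \sum_(0 <= s < j.+1) (P s)%:R = (w < j.+1)%N%:R :> R.
  move=> /(@sum_pick R _ _ _ _ (fun=> 1)) E; rewrite mulr1 in E; rewrite -[RHS]E.
  by apply: eq_bigr => s _; rewrite mulr1.
congr (_ - _).
- by apply: pick1 => s sj; rewrite shift0 eqmod_lt2 /u; try case: ifP => ?; lia.
by apply: pick1 => s sj; rewrite shift eqmod_lt2 /v; try case: ifP => ?; lia.
Qed.

(** Here i + e = i + N - d is at least N - 1 > m. *)
Let first_term0 : (d <= i.+1)%N -> a (i + e)%N l = 0.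
Proof. by move=> di; apply: aconv_gt; rewrite /e; lia. Qed.

(** Adjacent intervals: the second sum contributes its last term, whose factor [ahat] is the
    coefficient 1 of the shift. *)
Lemma bracket_next : d = i.+1 -> bracket m L i k j l = - a (i + j).+1 k.
Proof.
move=> di; rewrite bracketE first_term0 ?di // !mulr0 sub0r.
have -> : t = j.+1 by rewrite /t; case: ifP => ?; lia.
have -> : (u < j.+1)%N = false by rewrite /u; case: ifP => ?; lia.
have -> : (v < j.+1)%N = false by rewrite /v; case: ifP => ?; lia.
by rewrite subnn ltnSn /= subrr mulr0 addr0 mul1r mulr1 addnS.
Qed.

(** Both k and k+i lie in [l, l+j], so the chi part cancels and the product comes from the second
    sum. *)
Lemma bracket_same_start : d = 0%N -> (i < j)%N ->
  bracket m L i k j l = - (a i k * a j l).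
Proof.
move=> d0 ij; have kl : k = l %[mod N] by rewrite lE d0 addn0.
rewrite bracketE first_term0 ?d0 // !mulr0 sub0r.
have -> : t = (j - i)%N by rewrite /t; case: ifP => ?; lia.
have -> : (u < j.+1)%N = true by rewrite /u; case: ifP => ?; lia.
have -> : (v < j.+1)%N = true by rewrite /v; case: ifP => ?; lia.
have -> : (0 < j - i < j.+2)%N = true by lia.
have -> : (j.+1 - (j - i) = i.+1)%N by lia.
have -> : (i + (j - i) = j)%N by lia.
rewrite subrr mulr0 addr0 mul1r /= mulrC.
by rewrite (aconv_mod m L j kl) (aconv_mod m L i kl).
Qed.

(** Only k+i lies in [l, l+j], so the product comes from the chi part alone. *)
Lemma bracket_same_end : (j < i)%N -> d = (i - j)%N ->
  bracket m L i k j l = - (a i k * a j l).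
Proof.
move=> ji di; rewrite bracketE first_term0; last by lia.
have -> : (0 < t < j.+2)%N = false by rewrite /t; case: ifP => ?; lia.
have -> : (u < j.+1)%N = false by rewrite /u; case: ifP => ?; lia.
have -> : (v < j.+1)%N = true by rewrite /v; case: ifP => ?; lia.
by rewrite !mulr0 mul0r subrr add0r sub0r mulrN1.
Qed.

(** The interval [l, l+j] contains k+i but not k, which gives the first product; the second sum
    gives the other at s = d + j - i. *)
Lemma bracket_overlap : (0 < d <= i)%N -> (i < d + j)%N ->
  bracket m L i k j l = - (a i k * a j l) - a (j + d)%N k * a (i - d)%N l.
Proof.
move=> d0 idj; rewrite bracketE first_term0; last by lia.
have -> : t = (d + j - i)%N by rewrite /t; case: ifP => ?; lia.
have -> : (0 < d + j - i < j.+2)%N = true by lia.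
have -> : (u < j.+1)%N = false by rewrite /u; case: ifP => ?; lia.
have -> : (v < j.+1)%N = true by rewrite /v; case: ifP => ?; lia.
have -> : (j.+1 - (d + j - i) = (i - d).+1)%N by lia.
have -> : (i + (d + j - i) = j + d)%N by lia.
by rewrite !mulr0 mul1r !sub0r mulrN1 addrC.
Qed.

(** Here chi(k) = chi(k+i). The other two sums contribute only if [k, k+i] lies strictly inside
    [l, l+j], and then they cancel each other. *)
Lemma bracket_unlisted : ~ listed N i k j l -> ~ listed N j l i k ->
  bracket m L i k j l = 0.
Proof.
move=> nl nl'.
have kE : (k = l + (if d == 0 then 0 else N - d) %[mod N])%N.
  rewrite -(modnDml l) lE modnDml; case: eqP => [->|_]; first by rewrite !addn0.
  by rewrite -addnA subnKC ?modnDr // ltnW.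
have d1 : d != i.+1.
  by apply/eqP=> di; apply: nl; left; rewrite lE di -addnA addn1.
have d2 : ~ (i < j /\ d = 0)%N.
  by move=> [ij d0]; apply: nl; right; left; rewrite lE d0 addn0.
have d3 : ~ ((0 < d <= i) /\ (i <= d + j))%N.
  move=> [d0 idj]; apply: nl; have [dij|dij] := eqVneq d (i - j)%N.
    right; right; left; split; first by lia.
    by rewrite lE dij addnBA //; lia.
  have [ij|ij] := leqP i j; right; right; right; [left|right]; split; try lia;
    by exists d; split=> //; lia.
(* [f] is k - l modulo N, the offset with the two coordinates exchanged; [f1] to [f3] mirror [d1] to
   [d3]. *)
move: nl' kE; set f := (if _ then _ else _) => nl' kE.
have f1 : f != j.+1.
  by apply/eqP=> fj; apply: nl'; left; rewrite kE fj -addnA addn1.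
have f2 : ~ (j < i /\ f = 0)%N.
  by move=> [ij f0]; apply: nl'; right; left; rewrite kE f0 addn0.
have f3 : ~ ((0 < f <= j) /\ (j <= f + i))%N.
  move=> [f0 jfi]; apply: nl'; have [fji|fji] := eqVneq f (j - i)%N.
    right; right; left; split; first by lia.
    by rewrite kE fji addnBA //; lia.
  have [ij|ij] := leqP j i; right; right; right; [left|right]; split; try lia;
    by exists f; split=> //; lia.
rewrite bracketE; clear nl nl' kE lE first_term0.
have -> : (v < j.+1)%N = (u < j.+1)%N.
  by rewrite /u /v; move: f1 f2 f3; rewrite /f; do 2 case: ifP => ?; lia.
rewrite subrr mulr0 addr0.
(* The condition says that [k, k+i] is strictly nested in [l, l+j]. *)
have [ft|ft] := boolP ((i < j)%N && (0 < f < j - i)%N); last first.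
  have -> : (0 < e < j.+2)%N = false.
    by move: f1 f2 f3 ft; rewrite /e /f; case: ifP => ?; lia.
  have -> : (0 < t < j.+2)%N = false.
    by move: f1 f2 f3 ft; rewrite /t /f; do 2 case: ifP => ?; lia.
  by rewrite !mul0r subrr.
have fE : f = (N - d)%N by move: ft; rewrite /f; case: ifP => ?; lia.
have -> : (0 < e < j.+2)%N = true by rewrite /e; lia.
have -> : (0 < t < j.+2)%N = true by rewrite /t; case: ifP => ?; lia.
(* Both products turn into a_k^(j-f) a_l^(i+f). *)
have -> : (j.+1 - e = (j - f).+1)%N by rewrite /e; lia.
have -> : (i + e = i + f)%N by rewrite /e; lia.
have -> : (i + t = j - f)%N by rewrite /t; case: ifP => ?; lia.
have -> : (j.+1 - t = (i + f).+1)%N by rewrite /t; case: ifP => ?; lia.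
by rewrite subrr.
Qed.

End BracketValues.

(** * The Poisson submanifold and the table of brackets *)

Section Manifold.
Variables (R : numClosedFieldType) (n m : nat).
Local Notation N := n.+1.

Lemma poisson_submanifoldT : poisson_submanifold R N m.
Proof.
move=> L LT G gG; exists (hamV L G); split; first exact: hamV_tangent.
by move=> H _; apply: PB2_hamV.
Qed.

Lemma is_coord_b k : is_coord 0 k (@bcoord R N k).
Proof. by move=> X; rewrite /bcoord ent_inZp addn0 oppr0. Qed.

Lemma is_coord_a j k : is_coord j k (@acoord R N j k).
Proof. by move=> X; rewrite /acoord ent_inZp. Qed.

Lemma is_coord_conv j k : (j <= m)%N -> is_coord j k (@aconv R N m j k).
Proof.
move=> jm X; rewrite /aconv jm; case: eqP => [->|_]; first exact: is_coord_b.
exact: is_coord_a.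
Qed.

Lemma aconv_acoord (L : loop R N) j k : (1 <= j <= m)%N -> acoord j k L = aconv m j k L.
Proof. by case/andP; rewrite /aconv; case: j => // j _ ->. Qed.

Lemma PBval_bracket (L : loop R N) i k j l phi psi v : inT m L ->
  is_coord i k phi -> is_coord j l psi -> bracket m L i k j l = v -> PBval phi psi L v.
Proof. by move=> LT phiE psiE <-; apply: (PBval_coord phiE psiE); apply: hamV_coord. Qed.

End Manifold.

Theorem mainTheorem4 (R : numClosedFieldType) (N m : nat) :
  (1 <= m)%N -> (2 * m + 2 <= N)%N ->
  poisson_submanifold R N m /\
  forall L : loop R N, inT m L ->
  (forall k : nat,
     PBval (bcoord k) (bcoord k.+1) L (- acoord 1 k L)
  /\ (forall j : nat, (1 <= j <= m)%N ->
        PBval (bcoord k) (acoord j k.+1) L (- aconv m j.+1 k L)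
     /\ PBval (acoord j k) (bcoord (k + j).+1) L (- aconv m j.+1 k L)
     /\ PBval (bcoord k) (acoord j k) L (- (bcoord k L * acoord j k L))
     /\ PBval (acoord j k) (bcoord (k + j)) L (- (acoord j k L * bcoord (k + j) L)))
  /\ (forall i j : nat, (1 <= i <= m)%N -> (1 <= j <= m)%N ->
        PBval (acoord i k) (acoord j (k + i).+1) L (- aconv m (i + j).+1 k L)
     /\ ((i < j)%N ->
           PBval (acoord i k) (acoord j k) L (- (acoord i k L * acoord j k L))
        /\ PBval (acoord j k) (acoord i (k + j - i)) L
             (- (acoord j k L * acoord i (k + j - i) L)))
     /\ ((i <= j)%N -> forall ell : nat, (1 <= ell <= i)%N ->
           PBval (acoord i k) (acoord j (k + ell)) L
             (- (acoord i k L * acoord j (k + ell) L)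
              - aconv m (j + ell) k L * aconv m (i - ell) (k + ell) L))
     /\ ((i <= j)%N -> forall ell : nat, (j - i + 1 <= ell <= j)%N ->
           PBval (acoord j k) (acoord i (k + ell)) L
             (- (acoord j k L * acoord i (k + ell) L)
              - aconv m (i + ell) k L * aconv m (j - ell) (k + ell) L))))
  /\ (forall i k j l : nat, (i <= m)%N -> (j <= m)%N ->
        ~ listed N i k j l -> ~ listed N j l i k ->
        PBval (aconv m i k) (aconv m j l) L 0).
Proof.
move=> m1; case: N => [|n] mN; first by rewrite addn2 in mN.
split; first exact: poisson_submanifoldT.
move=> L LT.
have aT (j k : nat) := @aconv_acoord R n m L j k.
have b0 k : bcoord k L = aconv m 0 k L by [].
have cb := @is_coord_b R n; have ca := @is_coord_a R n.
split=> [k|i k j l im jm nl nl']; last first.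
  apply: (PBval_bracket LT (is_coord_conv _ im) (is_coord_conv _ jm)).
  (* The residue of l - k; reducing k first keeps the subtraction from being truncated. *)
  pose d := ((l + (n.+1 - k %% n.+1)) %% n.+1)%N.
  apply: (bracket_unlisted L mN (d := d)) => //; last by rewrite ltn_pmod.
  rewrite /d modnDmr -(modnDml k) addnCA subnKC ?modnDr //.
  by rewrite ltnW // ltn_pmod.
split.
  apply: (PBval_bracket LT (cb _) (cb _)); rewrite aT ?m1 //.
  by apply: (bracket_next L mN (d := 1)); rewrite ?addn1 //; lia.
split=> [j jm|i j im jm].
  rewrite !b0 !aT //; split; [|split; [|split]].
  - apply: (PBval_bracket LT (cb _) (ca _ _)).
    by apply: (bracket_next L mN (d := 1)); rewrite ?addn1 //; lia.
  - apply: (PBval_bracket LT (ca _ _) (cb _)).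
    by rewrite (bracket_next L mN (d := j.+1)) ?addn0 ?addnS //; lia.
  - apply: (PBval_bracket LT (cb _) (ca _ _)).
    by apply: (bracket_same_start L mN (d := 0)); rewrite ?addn0 //; lia.
  - apply: (PBval_bracket LT (ca _ _) (cb _)).
    by apply: (bracket_same_end L mN (d := j)) => //; lia.
split; [|split; [|split]].
- apply: (PBval_bracket LT (ca _ _) (ca _ _)).
  by apply: (bracket_next L mN (d := i.+1)); rewrite ?addnS //; lia.
- move=> ij; rewrite !aT //; split; apply: (PBval_bracket LT (ca _ _) (ca _ _)).
    by apply: (bracket_same_start L mN (d := 0)); rewrite ?addn0 //; lia.
  by apply: (bracket_same_end L mN (d := (j - i)%N)); rewrite ?addnBA //; lia.
- move=> ij ell li; rewrite !aT //; apply: (PBval_bracket LT (ca _ _) (ca _ _)).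
  by apply: (bracket_overlap L mN) => //; lia.
(* The overlap formula is used with i and j exchanged; its condition j < ell + i is the lower bound
   on [ell]. *)
- move=> ij ell lj; rewrite !aT //; apply: (PBval_bracket LT (ca _ _) (ca _ _)).
  by apply: (bracket_overlap L mN) => //; lia.
Qed.
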